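(* Let $n\ge4$ and $\sigma\in\Sigma_n$. Then the alter ego $\underset{\sim}{\mathbf C}_n^{\sigma}=(C_n;\sigma_1,\dots,\sigma_{n-2},\mathscr T)$ yields a full duality on $\mathcal G_n$ if and only if $\sigma=(g_1,\dots,g_{n-3},h_1)$.
   Context: $\mathbf C_n$ is the Heyting algebra on the chain $\{0<1<\dots<n-1\}$, with min, max, $\bot=0$, $\top=n-1$, $a\to b=\top$ if $a\le b$, $a\to b=b$ if $b<a$. $\mathcal G_n$ is the class of algebras isomorphic to subalgebras of direct powers of $\mathbf C_n$; $\mathcal G_n(\mathbf A,\mathbf C_n)$ is the set of Heyting homomorphisms $\mathbf A\to\mathbf C_n$. For $n\ge4$: for $1\le i\le n-2$, $h_i$ is the endomorphism of $\mathbf C_n$ with $h_i(k)=k+1$ if $i\le k<n-1$ and $h_i(k)=k$ otherwise. For $1\le i\le n-3$, $g_i$ is the partial map with domain $C_n\setminus\{i\}$ with $g_i(i+1)=i$, $g_i(k)=k$ for $k\notin\{i,i+1\}$, and $f_i\colon C_n\setminus\{i+1\}\to C_n\setminus\{i\}$ is its inverse; these are partial endomorphisms. $\Sigma_n=\{f_1,g_1\}\times\dots\times\{f_{n-3},g_{n-3}\}\times\{h_1,\dots,h_{n-2}\}$, elements written $\sigma=(\sigma_1,\dots,\sigma_{n-2})$. $\mathscr T$ is the discrete topology. Natural duality set-up: powers of the alter ego carry the product topology and pointwise-lifted operations ($p^S(x)=p\circ x$, defined iff $x(s)\in\operatorname{dom}p$ for all $s$); a substructure is a subset closed under these (partial)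 operations wherever defined; $\mathcal X^\sigma$ is the class of topological structures isomorphic to closed substructures of powers of $\underset{\sim}{\mathbf C}_n^{\sigma}$ (empty one included), with morphisms the continuous maps $\varphi$ preserving total operations and such that, for partial $p$, $x\in\operatorname{dom}p^{\mathbf X}$ implies $\varphi(x)\in\operatorname{dom}p^{\mathbf Y}$ and $\varphi(p^{\mathbf X}(x))=p^{\mathbf Y}(\varphi(x))$. $D(\mathbf A)=\mathcal G_n(\mathbf A,\mathbf C_n)$ as a closed substructure of the power with exponent $A$; $E(\mathbf X)$ is the set of morphisms from $\mathbf X$ to $\underset{\sim}{\mathbf C}_n^{\sigma}$, a subalgebra of $\mathbf C_n^X$. The alter ego yields a duality on $\mathcal G_n$ if for all $\mathbf A\in\mathcal G_n$ the evaluation $e_{\mathbf A}\colon\mathbf A\to ED(\mathbf A)$, $e_{\mathbf A}(a)(x)=x(a)$, is an isomorphism; it yields a full duality if in addition for every $\mathbf X\in\mathcal X^\sigma$ the evaluation $\varepsilon_{\mathbf X}\colon\mathbf X\to DE(\mathbf X)$, $\varepsilon_{\mathbf X}(x)(\alpha)=\alpha(x)$, is an isomorphism in $\mathcal X^\sigma$. *)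

(* Defs.v *)
From mathcomp Require Import all_boot.
From Stdlib Require List.

Unset Printing Implicit Defensive.

(* Carrier 'I_(n.-1).+1, which is {0,...,n-1} for n >= 1 (we use n >= 4). *)
Definition Cn (n : nat) : Type := 'I_(n.-1).+1.

Definition cmeet (n : nat) (a b : Cn n) : Cn n := if (a <= b)%N then a else b.
Definition cjoin (n : nat) (a b : Cn n) : Cn n := if (a <= b)%N then b else a.
Definition cimp (n : nat) (a b : Cn n) : Cn n := if (a <= b)%N then ord_max else b.
Definition cbot  n : Cn n := ord0.
Definition ctop  n : Cn n := ord_max.

Record HAlg := {
  hcar :> Type;
  hmeet : hcar -> hcar -> hcar;
  hjoin : hcar -> hcar -> hcar;
  himp  : hcar -> hcar -> hcar;
  hbot  : hcar;
  htop  : hcar }.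

Definition is_hom (A B : HAlg) (f : A -> B) : Prop :=
  (forall a b, f (hmeet A a b) = hmeet B (f a) (f b)) /\
  (forall a b, f (hjoin A a b) = hjoin B (f a) (f b)) /\
  (forall a b, f (himp A a b) = himp B (f a) (f b)) /\
  f (hbot A) = hbot B /\ f (htop A) = htop B.

Definition Cn_alg (n : nat) : HAlg :=
  {| hcar := Cn n; hmeet := cmeet n; hjoin := cjoin n; himp := cimp n;
     hbot := cbot n; htop := ctop n |}.

Definition Cpow (n : nat) (S : Type) : HAlg :=
  {| hcar := S -> Cn n;
     hmeet := fun x y s => cmeet n (x s) (y s);
     hjoin := fun x y s => cjoin n (x s) (y s);
     himp  := fun x y s => cimp n (x s) (y s);
     hbot  := fun _ => cbot n;
     htop  := fun _ => ctop n |}.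

(* A is in G_n : A is isomorphic to a subalgebra of a direct power of C_n,
   i.e. there is an injective homomorphism of A into some C_n^S. *)
Definition in_Gn (n : nat) (A : HAlg) : Prop :=
  exists (S : Type) (f : hcar A -> S -> Cn n), injective f /\ is_hom A (Cpow n S) f.

Definition pop (n : nat) := Cn n -> option (Cn n).

Definition hmap n (i : nat) : pop n := fun k =>
  Some (if (i <= k)%N && (k < n.-1)%N then insubd k k.+1 else k).
Definition gmap n (i : nat) : pop n := fun k =>
  if val k == i then None else Some (if val k == i.+1 then insubd k i else k).
(* f_i : C_n \ {i+1} -> C_n \ {i}, inverse of g_i: f_i(i) = i+1 *)
Definition fmap n (i : nat) : pop n := fun k =>
  if val k == i.+1 then None else Some (if val k == i then insubd k i.+1 else k).

(* sigma = (sigma_1,...,sigma_{n-2}) in Sigma_n is encoded by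
   c : 'I_(n-3) -> bool  (c k = true  <-> sigma_{k+1} = g_{k+1},
                          c k = false <-> sigma_{k+1} = f_{k+1})
   j : 'I_(n-2)          (sigma_{n-2} = h_{j+1}).
   Operation number i : 'I_(n-2) is sigma_{i+1}. *)
Definition sigma_op n (c : 'I_(n-3) -> bool) (j : 'I_(n-2)) (i : 'I_(n-2)) : pop n :=
  match (insub (val i) : option 'I_(n-3)) with
  | Some k => if c k then gmap n (val k).+1 else fmap n (val k).+1
  | None => hmap n (val j).+1
  end.

(* Abstract structure: carrier, family of open sets, and the graphs of the
   (partial) operations: trel i x x' means "sigma_{i+1}^X(x) is defined and = x'". *)
Record TStr (n : nat) := {
  tcar :> Type;
  topen : (tcar -> Prop) -> Prop;
  trel : 'I_(n-2) -> tcar -> tcar -> Prop }.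

(* Subsets of a power C_n^S (product topology, C_n discrete). *)
Definition closedP n (S : Type) (Y : (S -> Cn n) -> Prop) : Prop :=
  forall x, ~ Y x -> exists F : list S,
    forall y, (forall s, List.In s F -> y s = x s) -> ~ Y y.

Definition substrP n (ops : 'I_(n-2) -> pop n) (S : Type) (Y : (S -> Cn n) -> Prop) : Prop :=
  forall i x, Y x -> (forall s, ops i (x s) <> None) ->
    Y (fun s => odflt (x s) (ops i (x s))).

(* V (a subset of Y) is open in the subspace topology of Y in C_n^S *)
Definition popen n (S : Type) (Y : (S -> Cn n) -> Prop) (V : (S -> Cn n) -> Prop) : Prop :=
  forall y, V y -> exists F : list S,
    forall z, Y z -> (forall s, List.In s F -> z s = y s) -> V z.

Definition iso_into n (ops : 'I_(n-2) -> pop n) (X : TStr n) (S : Type)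
    (Y : (S -> Cn n) -> Prop) (phi : X -> S -> Cn n) : Prop :=
  (forall x, Y (phi x)) /\ injective phi /\
  (forall y, Y y -> exists x, phi x = y) /\
  (forall U : X -> Prop,
      topen n X U <-> popen n S Y (fun y => exists x, U x /\ phi x = y)) /\
  (forall i x x', trel n X i x x' <-> (forall s, ops i (phi x s) = Some (phi x' s))).

Definition in_Xsig n (ops : 'I_(n-2) -> pop n) (X : TStr n) : Prop :=
  exists (S : Type) (Y : (S -> Cn n) -> Prop) (phi : X -> S -> Cn n),
    closedP n S Y /\ substrP n ops S Y /\ iso_into n ops X S Y phi.

(* morphisms X -> alter ego (C_n; sigma; discrete topology) *)
Definition isE n (ops : 'I_(n-2) -> pop n) (X : TStr n) (alpha : X -> Cn n) : Prop :=
  (forall V : Cn n -> Prop, topen n X (fun x => V (alpha x))) /\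
  (forall i x x', trel n X i x x' -> ops i (alpha x) = Some (alpha x')).

(* D(A) = G_n(A, C_n), closed substructure of C_n^A *)
Notation DA n A := {x : hcar A -> Cn n | is_hom A (Cn_alg n) x}.

Definition Dstr n (ops : 'I_(n-2) -> pop n) (A : HAlg) : TStr n :=
  {| tcar := DA n A;
     topen := fun U => forall x, U x -> exists F : list A,
                forall y : DA n A, (forall a, List.In a F -> proj1_sig y a = proj1_sig x a) -> U y;
     trel := fun i x x' => forall a, ops i (proj1_sig x a) = Some (proj1_sig x' a) |}.

Definition evalA n (A : HAlg) (a : A) : DA n A -> Cn n := fun x => proj1_sig x a.

Definition e_iso n (ops : 'I_(n-2) -> pop n) (A : HAlg) : Prop :=
  (forall a, isE n ops (Dstr n ops A) (evalA n A a)) /\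
  injective (evalA n A) /\
  (forall alpha, isE n ops (Dstr n ops A) alpha -> exists a, evalA n A a = alpha) /\
  is_hom A (Cpow n (DA n A)) (evalA n A).

Notation EX n ops X := {alpha : tcar n X -> Cn n | isE n ops X alpha}.

(* beta : E(X) -> C_n is a Heyting homomorphism (operations of E(X) are the
   pointwise ones of C_n^X, restricted to E(X)) *)
Definition EX_hom n (ops : 'I_(n-2) -> pop n) (X : TStr n) (beta : EX n ops X -> Cn n) : Prop :=
  (forall a b c : EX n ops X, (forall x, proj1_sig c x = cmeet n (proj1_sig a x) (proj1_sig b x)) ->
      beta c = cmeet n (beta a) (beta b)) /\
  (forall a b c : EX n ops X, (forall x, proj1_sig c x = cjoin n (proj1_sig a x) (proj1_sig b x)) ->
      beta c = cjoin n (beta a) (beta b)) /\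
  (forall a b c : EX n ops X, (forall x, proj1_sig c x = cimp n (proj1_sig a x) (proj1_sig b x)) ->
      beta c = cimp n (beta a) (beta b)) /\
  (forall a : EX n ops X, (forall x, proj1_sig a x = cbot n) -> beta a = cbot n) /\
  (forall a : EX n ops X, (forall x, proj1_sig a x = ctop n) -> beta a = ctop n).

(* epsilon_X : X -> DE(X), DE(X) a closed substructure of C_n^{E(X)} *)
Definition epsX n (ops : 'I_(n-2) -> pop n) (X : TStr n) (x : X) : EX n ops X -> Cn n :=
  fun alpha => proj1_sig alpha x.

Definition eps_iso n (ops : 'I_(n-2) -> pop n) (X : TStr n) : Prop :=
  iso_into n ops X (EX n ops X) (EX_hom n ops X) (epsX n ops X).

Definition full_duality n (ops : 'I_(n-2) -> pop n) : Prop :=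
  (forall A : HAlg, in_Gn n A -> e_iso n ops A) /\
  (forall X : TStr n, in_Xsig n ops X -> eps_iso n ops X).

(* Main.v *)
Require Import Defs.
From mathcomp Require Import all_boot.
From mathcomp Require Import zify.
From mathcomp Require Import boolp classical_sets.

(** Necessity. Restricted to [0 < k < n-1], the operations move [k] only to [k-1]
    (by [g_(k-1)]) or to [k+1] (by [f_k] or [h_j]); all of these points are
    mutually reachable exactly when every [g_i] occurs and [j = 1]. Otherwise some
    substructure of the alter ego contains one such [k] but not another such [l],
    and it lacks a point of its double dual, namely evaluation at [k] with [k]
    replaced by [l].

    Sufficiency. For a homomorphism [x] to the chain and a threshold [v > 0], the
    set [{a | v <= x a}] is a prime filter. Applying [h_1] repeatedly moves the
    threshold to the top, and the [g_i] then compress the range to an initial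
    segment of the chain together with the top, without changing the filter; such a
    normal form is determined by its filter. Hence a morphism [alpha] on [D(A)] is
    determined by an upward closed family of prime filters, which gives, for all
    [x] and [y], some [a] with [alpha x <= a(x)] and [a(y) <= alpha y]; compactness,
    used once with joins and once with meets, makes [alpha] an evaluation. For
    [beta] in [DE(X)], compactness of [X] yields [x] in [X] and [v] with the filter
    of [beta] at the top; [x] and [beta] then have the same normal form, and [beta]
    is in [X] because [X] is also closed under the [f_i], which are compositions of
    the [g_i] and [h_1]. *)

(** * Compactness of closed subsets of powers *)

(* Tychonoff for C_n^S: by Zorn, take a maximal set [G] of pairs (s, v) none of
   whose finite parts carves out of [Y] a piece covered by one member of the
   directed family; maximality makes [G] contain the graph of a point. *)
Lemma directed_compactness n (S : Type) (Y : (S -> Cn n) -> Prop)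
    (J : Type) (Q : J -> Prop) (U : J -> (S -> Cn n) -> Prop) :
  closedP n S Y ->
  (exists j, Q j) ->
  (forall i j, Q i -> Q j ->
     exists k, Q k /\ forall y, U i y \/ U j y -> U k y) ->
  (forall y, Y y -> exists j, Q j /\ exists F : list S,
     forall z, Y z -> (forall s, List.In s F -> z s = y s) -> U j z) ->
  exists j, Q j /\ forall y, Y y -> U j y.
Proof.
move=> clY [j0 Qj0] dirQ cov; apply: contrapT => ncov.
pose sat (L : list (S * Cn n)) y := forall p, List.In p L -> y p.1 = p.2.
pose covered L := exists j, Q j /\ forall y, Y y -> sat L y -> U j y.
pose P (G : set (S * Cn n)) :=
  forall L, (forall p, List.In p L -> G p) -> ~ covered L.
have chainP (F : set (set (S * Cn n))) : (forall G, F G -> P G) ->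
    total_on F subset -> P (bigcup F id).
  move=> FP Ftot L LF.
  have [->|[G FG LG]] :
      L = nil \/ exists2 G, F G & forall p, List.In p L -> G p.
    elim: L LF => [|p L IH] LF; first by left.
    right; have [G FG Gp] := LF p (or_introl erefl).
    have [->|[H FH LH]] := IH (fun q Lq => LF q (or_intror Lq)).
      by exists G => // q [<-|[]].
    have [GH|HG] := Ftot _ _ FG FH.
      by exists H => // q [<-|/LH //]; apply: GH.
    by exists G => // q [<- //|/LH]; apply: HG.
  - by move=> [j [Qj Uj]]; apply: ncov; exists j; split=> // y Yy; apply: Uj.
  - exact: (FP _ FG).
have [G [PG Gmax]] := Zorn_bigcup chainP.
(* Otherwise, by maximality, adjoining any [(s, v)] to [G] creates a covered finite part; as [v] has
   finitely many values, directedness merges these covers into one of a finite part of [G]. *)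
have Gtot s : exists v, G (s, v).
  apply: contrapT => /forallNP noG.
  have ext v : exists L, (forall p, List.In p L -> G p) /\
      exists j, Q j /\ forall y, Y y -> sat L y -> y s = v -> U j y.
    pose Gv p := G p \/ p = (s, v).
    have [L [LGv [j [Qj Uj]]]] : exists L, (forall p, List.In p L -> Gv p) /\ covered L.
      apply: contrapT => /forallNP NL; apply: (Gmax Gv).
        by split=> [p Gp|/(_ (s, v)) H]; [left|apply: (noG v); apply: H; right].
      by move=> L LGv cL; apply: (NL L).
    have [L' [L'G L'L]] : exists L', (forall p, List.In p L' -> G p) /\
        forall y, sat L' y -> y s = v -> sat L y.
      elim: L LGv {Uj} => [|p L IH] LGv; first by exists nil.
      have [L' [L'G L'L]] := IH (fun q Lq => LGv q (or_intror Lq)).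
      have [Gp|->] := LGv p (or_introl erefl).
        exists (p :: L'); split=> [q [<- //|/L'G //]|y sy ys q].
        move=> [<-|Lq]; first exact/sy/or_introl.
        by apply: (L'L y) => // r Lr; apply/sy/or_intror.
      by exists L'; split=> // y sy ys q [<- //|]; apply: L'L.
    by exists L'; split=> //; exists j; split=> // y Yy sy ys; apply: Uj => //; apply: L'L.
  have [L [LG [j [Qj Uj]]]] : exists L, (forall p, List.In p L -> G p) /\
      exists j, Q j /\ forall y, Y y -> sat L y ->
        (y s : 'I_(n.-1).+1) \in enum 'I_(n.-1).+1 -> U j y.
    elim: (enum _) => [|v vs [L [LG [j [Qj Uj]]]]].
      by exists nil; split=> //; exists j0.
    have [M [MG [i [Qi Ui]]]] := ext v.
    have [k [Qk Uk]] := dirQ _ _ Qi Qj.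
    exists (M ++ L)%list; split=> [p /List.in_app_iff[/MG|/LG]//|].
    exists k; split=> // y Yy sy; rewrite inE => /orP[/eqP ys|ys]; apply: Uk.
      by left; apply: Ui => // p Mp; apply/sy/List.in_app_iff; left.
    by right; apply: Uj => // p Lp; apply/sy/List.in_app_iff; right.
  apply: (PG L LG); exists j; split=> // y Yy sy.
  by apply: Uj; rewrite // mem_enum.
have [f fG] := choice Gtot.
have graphG F p : List.In p (List.map (fun s => (s, f s)) F) -> G p.
  by move=> /List.in_map_iff[s [<- _]].
have satf F z : sat (List.map (fun s => (s, f s)) F) z ->
    forall s, List.In s F -> z s = f s.
  by move=> sz s Fs; apply: (sz (s, f s)); apply/List.in_map_iff; exists s.
(* In [Y], a neighbourhood of [f] is covered; outside, closedness yields a finite part of its graph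
   that no point of [Y] satisfies, which is covered vacuously. *)
have [Yf|nYf] := EM (Y f).
  have [j [Qj [F UF]]] := cov f Yf.
  apply: (PG _ (graphG F)); exists j; split=> // y Yy /satf; exact: UF.
have [F NF] := clY f nYf.
by apply: (PG _ (graphG F)); exists j0; split=> // y Yy /satf /NF.
Qed.

(** * Partial endomorphisms of the chain *)

Lemma gmapP n i (a b : Cn n) : (i < n.-1)%N ->
  gmap n i a = Some b <->
  (a <> i :> nat /\ b = (if a == i.+1 :> nat then i else a) :> nat).
Proof.
rewrite /gmap /= => hi.
have hv : val (if val a == i.+1 then insubd a i else a) =
    (if a == i.+1 :> nat then i else a).
  by case: (altP (val a =P _)) => //= e; rewrite val_insubd; case: ifP => //; lia.
case: eqP => e; first by split => // -[].
split; first by move=> [<-].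
by move=> [_ hb]; congr Some; apply: val_inj; rewrite hv.
Qed.

Lemma fmapP n i (a b : Cn n) : (i.+1 < n)%N ->
  fmap n i a = Some b <->
  (a <> i.+1 :> nat /\ b = (if a == i :> nat then i.+1 else a) :> nat).
Proof.
rewrite /fmap /= => hi.
have hv : val (if val a == i then insubd a i.+1 else a) =
    (if a == i :> nat then i.+1 else a).
  by case: (altP (val a =P _)) => //= e; rewrite val_insubd; case: ifP => //; lia.
case: eqP => e; first by split => // -[].
split; first by move=> [<-].
by move=> [_ hb]; congr Some; apply: val_inj; rewrite hv.
Qed.

Lemma hmapP n i (a b : Cn n) :
  hmap n i a = Some b <->
  b = (if (i <= a < n.-1)%N then a.+1 else a) :> nat.
Proof.
rewrite /hmap.
have hv : val (if (i <= a)%N && (a < n.-1)%N then insubd a a.+1 else a) =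
    (if (i <= a < n.-1)%N then a.+1 else a).
  by case: ifP => //= e; rewrite val_insubd; case: ifP => //; lia.
split; first by move=> [<-].
by move=> hb; congr Some; apply: val_inj; rewrite hv.
Qed.

Section PartialEndomorphisms.
Variable n : nat.
Implicit Types (p : pop n) (a b : Cn n) (A : HAlg).

Lemma cn_le a : (a <= n.-1)%N.
Proof. by rewrite -ltnS ltn_ord. Qed.

Lemma ctopP a : a = ctop n <-> a = n.-1 :> nat.
Proof. by split=> [->//|h]; apply: val_inj. Qed.

Lemma cimp_top a b : cimp n a b = ctop n <-> (a <= b)%N.
Proof.
rewrite /cimp; case: leqP => // h; split=> // /ctopP hb.
by have := cn_le a; lia.
Qed.

(* Order-theoretic form of: [p] is a partial Heyting endomorphism of the chain. *)
Definition pendo p :=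
  [/\ p (cbot n) = Some (cbot n), p (ctop n) = Some (ctop n),
   forall a b a' b', p a = Some a' -> p b = Some b' -> (a <= b)%N -> (a' <= b')%N &
   forall a b a' b', p a = Some a' -> p b = Some b' -> (b < a)%N ->
     (b' < a')%N \/ b' = ctop n].

Lemma pendo_meet p a b a' b' : pendo p -> p a = Some a' -> p b = Some b' ->
  p (cmeet n a b) = Some (cmeet n a' b').
Proof.
move=> [_ _ mono smono] pa pb; rewrite /cmeet; case: leqP => ab.
  by rewrite (mono _ _ _ _ pa pb ab).
rewrite pb; congr Some; case: leqP => // le.
by apply: val_inj; apply/eqP; rewrite eqn_leq le andbT (mono _ _ _ _ pb pa (ltnW ab)).
Qed.

Lemma pendo_join p a b a' b' : pendo p -> p a = Some a' -> p b = Some b' ->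
  p (cjoin n a b) = Some (cjoin n a' b').
Proof.
move=> [_ _ mono smono] pa pb; rewrite /cjoin; case: leqP => ab.
  by rewrite (mono _ _ _ _ pa pb ab).
rewrite pa; congr Some; case: leqP => // le.
by apply: val_inj; apply/eqP; rewrite eqn_leq le (mono _ _ _ _ pb pa (ltnW ab)).
Qed.

(** If [b < a], the implication is [b], and [b'] equals [cimp n a' b'] exactly because the images
    stay strictly ordered unless [b'] is the top. *)
Lemma pendo_imp p a b a' b' : pendo p -> p a = Some a' -> p b = Some b' ->
  p (cimp n a b) = Some (cimp n a' b').
Proof.
move=> [_ ptop mono smono] pa pb; rewrite /cimp; case: leqP => ab.
  by rewrite (mono _ _ _ _ pa pb ab).
rewrite pb; congr Some; case: leqP => // le.
by case: (smono _ _ _ _ pa pb ab) => //; lia.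
Qed.

Lemma pendo_comp_hom p A (x x' : A -> Cn n) : pendo p ->
  is_hom A (Cn_alg n) x -> (forall u, p (x u) = Some (x' u)) ->
  is_hom A (Cn_alg n) x'.
Proof.
move=> ep [xm [xj [xi [xb xt]]]] px; have [pb pt _ _] := ep.
have inj (a b : Cn n) : Some a = Some b -> a = b by case.
split; [|split; [|split; [|split]]] => [u v|u v|u v||]; apply: inj; rewrite -px.
- by rewrite xm; apply: pendo_meet.
- by rewrite xj; apply: pendo_join.
- by rewrite xi; apply: pendo_imp.
- by rewrite xb.
- by rewrite xt.
Qed.

Lemma pendo_gmap i : (0 < i)%N -> (i.+1 < n.-1)%N -> pendo (gmap n i).
Proof.
move=> i0 iN; have iN' : (i < n.-1)%N by lia.
split=> [||a b a' b' /(gmapP _ _ _ _ iN')[ha ea] /(gmapP _ _ _ _ iN')[hb eb]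
         |a b a' b' /(gmapP _ _ _ _ iN')[ha ea] /(gmapP _ _ _ _ iN')[hb eb]].
- by apply/gmapP => //=; split; try case: ifP; lia.
- by apply/gmapP => //=; split; try case: ifP; lia.
- by move: ea eb; do 2 (case: ifP => ?); lia.
- by left; move: ea eb; do 2 (case: ifP => ?); lia.
Qed.

Lemma pendo_hmap i : (0 < i)%N -> pendo (hmap n i).
Proof.
move=> i0; split=> [||a b a' b' /hmapP ea /hmapP eb
         |a b a' b' /hmapP ea /hmapP eb]; try apply/hmapP; try rewrite ctopP /=.
- by case: ifP => //=; lia.
- by case: ifP => //=; lia.
- by have := cn_le b; move: ea eb; do 2 (case: ifP => ?); lia.
- by have := cn_le a; move: ea eb; do 2 (case: ifP => ?); lia.
Qed.

Lemma hom_le A (x : A -> Cn n) u v : is_hom A (Cn_alg n) x ->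
  (x u <= x v)%N <-> x (himp A u v) = ctop n.
Proof. by move=> [_ [_ [-> _]]]; rewrite cimp_top. Qed.

End PartialEndomorphisms.

(** * Normal forms *)

Lemma max_witness n (T : Type) (P : T -> Prop) (x : T -> Cn n) :
  (exists a, P a) -> exists a0, P a0 /\ forall a, P a -> (x a <= x a0)%N.
Proof.
move=> [a Pa].
pose p m := `[< exists b, P b /\ x b = m :> nat >].
have exp : exists m, p m by exists (x a); apply/asboolP; exists a.
have pub m : p m -> (m <= n.-1)%N by move=> /asboolP[b [_ <-]]; apply: cn_le.
case: (ex_maxnP exp pub) => m /asboolP[b [Pb <-]] maxb.
by exists b; split=> // c Pc; apply: maxb; apply/asboolP; exists c.
Qed.

(** Apart from the top, the range is an initial segment of the chain: no [gmap n i] with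
    [i.+1 < n.-1] can compress it further. *)
Definition initial n (T : Type) (z : T -> Cn n) :=
  forall a k, (k < z a)%N -> (z a < n.-1)%N -> exists b, z b = k :> nat.

(** By induction on [z a]: a value [k.+1] below the top has some [b] at [k], and [z' b < z' a]
    pushes [z' a] up to at least [k.+1]. *)
Lemma initial_le n (T : Type) (z z' : T -> Cn n) :
  initial n T z ->
  (forall a b, (z a <= z b)%N <-> (z' a <= z' b)%N) ->
  (forall a, z a = ctop n -> z' a = ctop n) ->
  forall a, (z a <= z' a)%N.
Proof.
move=> iz ord top a; have [m] := ubnP (z a); elim: m a => // m IH a lem.
have [/ctopP/top->|ntop] := EM (z a = n.-1 :> nat); first exact: cn_le.
have zlt : (z a < n.-1)%N by have := cn_le n (z a); lia.
case za: (nat_of_ord (z a)) => [//|k].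
have [|b zb] := iz a k _ zlt; first by lia.
have := IH b; have := proj2 (ord a b); lia.
Qed.

Lemma initial_unique n (T : Type) (z z' : T -> Cn n) :
  initial n T z -> initial n T z' ->
  (forall a b, (z a <= z b)%N <-> (z' a <= z' b)%N) ->
  (forall a, z a = ctop n <-> z' a = ctop n) -> z = z'.
Proof.
move=> iz iz' ord top; apply: funext => a; apply: val_inj; apply/eqP.
rewrite eqn_leq (initial_le _ _ _ _ iz) //=; last by move=> ? /top.
by apply: initial_le => // [? ?|? /top //]; split=> /ord.
Qed.

(* Each [g_i] that moves something lowers the sum of the range. *)
Lemma initial_reachable n (A X : Type) (ev : X -> A -> Cn n) (t : X -> Prop) :
  (forall x, exists a, ev x a = cbot n) ->
  (forall x i, (0 < i)%N -> (i.+1 < n.-1)%N -> (forall a, ev x a <> i :> nat) ->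
     exists x', (forall a, gmap n i (ev x a) = Some (ev x' a)) /\ (t x <-> t x')) ->
  forall x, exists x',
    [/\ initial n A (ev x'), forall a, ev x a = ctop n <-> ev x' a = ctop n &
        t x <-> t x'].
Proof.
move=> bot hg x.
pose R x := [set k : 'I_(n.-1).+1 | `[< exists a, ev x a = k >]].
have [m] := ubnP (\sum_(k in R x) k)%N; elim: m x => // m IH x lem.
have [inx|/existsNP[a /existsNP[k]]] := EM (initial n A (ev x)); first by exists x.
move=> /not_implyP[ka] /not_implyP[an] /forallNP nk.
(* The least value of the range above the gap [k] is some [i.+1]; then [i] is missing, so [gmap n i]
   is defined and moves [i.+1] down. *)
pose p l := (k < l)%N && `[< exists b, ev x b = l :> nat >].
have exp : exists l, p l by exists (ev x a); rewrite /p ka; apply/asboolP; exists a.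
case: (ex_minnP exp) => l /andP[kl /asboolP[b xb]] minl.
have la : (l <= ev x a)%N by apply: minl; rewrite /p ka; apply/asboolP; exists a.
case: l => // i in kl xb minl la.
have i0 : (0 < i)%N.
  have [c xc] := bot x; rewrite lt0n; apply/eqP => ei; apply: (nk c); rewrite xc /=; lia.
have ni c : ev x c <> i :> nat.
  move=> xc; have [ik|ki] := eqVneq i k; first by apply: (nk c); rewrite xc.
  have : (i.+1 <= i)%N.
    by apply: minl; rewrite /p; apply/andP; split; [lia|apply/asboolP; exists c].
  by rewrite ltnn.
have iN : (i.+1 < n.-1)%N by lia.
have [x' [gx tx]] := hg x i i0 iN ni.
have iN' : (i < n.-1)%N by lia.
have gv c : ev x' c = (if ev x c == i.+1 :> nat then i else ev x c) :> nat.
  by have /(gmapP _ _ _ _ iN')[] := gx c.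
have Ri1 : inord i.+1 \in R x.
  by rewrite inE; apply/asboolP; exists b; apply: val_inj; rewrite /= xb inordK; lia.
have Ri : inord i \notin R x :\ inord i.+1.
  rewrite !inE negb_and; apply/orP; right; apply/asboolPn => -[c xc].
  by apply: (ni c); rewrite xc inordK; lia.
have RE : R x' = inord i |: (R x :\ inord i.+1).
  apply/setP=> l; rewrite !inE; apply/asboolP/orP.
    move=> [c xc]; have := gv c; rewrite xc; case: ifP => ec el.
      by left; apply/eqP; apply: val_inj; rewrite /= inordK ?el //; lia.
    right; apply/andP; split.
      by apply/eqP => e; move: ec el; rewrite e inordK; lia.
    by apply/asboolP; exists c; apply: val_inj; rewrite /= el.
  move=> [/eqP->|/andP[/eqP nl /asboolP[c xc]]].
    by exists b; apply: val_inj; rewrite /= gv xb eqxx inordK; lia.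
  exists c; apply: val_inj; rewrite /= gv xc; case: eqP => // el.
  by case: nl; apply: val_inj; rewrite /= inordK; lia.
have [|x'' [inx'' top'' t'']] := IH x'.
  move: lem; rewrite (big_setD1 _ Ri1) RE big_setU1 //= !inordK; lia.
exists x''; split=> // [c|]; last by rewrite tx.
rewrite -top''; split=> /ctopP h; apply/ctopP; move: (gv c); case: ifP; lia.
Qed.

(** Each use of [hmap n 1] raises the values strictly between 0 and the top by one, so after
    [n.-1 - v] uses exactly those that were at least [v] are at the top. *)
Lemma shift_to_top n (T X : Type) (ev : X -> T -> Cn n) :
  (forall x, exists x', forall a, hmap n 1 (ev x a) = Some (ev x' a)) ->
  forall x v, (0 < v)%N -> (v <= n.-1)%N ->
    exists x', forall a, (v <= ev x a)%N <-> ev x' a = ctop n.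
Proof.
move=> hh x v v0 vn; have [m] := ubnP (n.-1 - v)%N.
elim: m x v v0 vn => // m IH x v v0 vn lem.
have [ev1|vlt] := leqP n.-1 v.
  by exists x => a; rewrite ctopP; have := cn_le n (ev x a); lia.
have [x' hx'] := hh x; have [//|//||x'' hx''] := IH x' v.+1; first lia.
exists x'' => a; rewrite -hx''.
by have /hmapP -> := hx' a; have := cn_le n (ev x a); case: ifP; lia.
Qed.

(* [f_i = g_(i-1) o ... o g_1 o h_1 o g_(n-3) o ... o g_(i+1)] on [C_n \ {i+1}]. *)
Lemma f_closed n (A : Type) (P : (A -> Cn n) -> Prop) :
  (forall z z' i, (0 < i)%N -> (i.+1 < n.-1)%N -> P z ->
     (forall a, gmap n i (z a) = Some (z' a)) -> P z') ->
  (forall z z', P z -> (forall a, hmap n 1 (z a) = Some (z' a)) -> P z') ->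
  forall z z' i, (0 < i)%N -> (i.+1 < n.-1)%N -> P z ->
     (forall a, fmap n i (z a) = Some (z' a)) -> P z'.
Proof.
move=> Pg Ph z z' i i0 iN Pz fz.
have {}fz a : z a <> i.+1 :> nat /\ z' a = (if z a == i :> nat then i.+1 else z a) :> nat.
  by apply/fmapP => //; lia.
have zn a : (z a <= n.-1)%N by apply: cn_le.
(* [down m] is the composite of [gmap n i.+1], ..., [gmap n m.-1], in this order: the values from
   [i.+2] to [m] move into the gap at [i.+1]. *)
pose down m k := if (i.+1 < k <= m)%N then k.-1 else k.
pose up m k := if (m <= k <= i)%N then k.+1 else k.
have inordE k : (k <= n.-1)%N -> (inord k : Cn n) = k :> nat by move=> ?; rewrite inordK.
have Pdown d : (i.+1 + d < n.-1)%N -> P (fun a => inord (down (i.+1 + d)%N (z a))).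
  elim: d => [|d IH] lt.
    suff -> : (fun a => inord (down (i.+1 + 0)%N (z a))) = z by [].
    apply: funext => a; apply: val_inj; have zna := zn a.
    by rewrite /down /= inordE; repeat case: ifP; lia.
  apply: (Pg _ _ (i.+1 + d)%N _ _ (IH _)); try lia.
  move=> a; apply/gmapP; first lia.
  have zna := zn a; have [za _] := fz a.
  by rewrite /down !inordE; repeat case: ifP; lia.
(* After [down (n - 2)], [hmap n 1] restores the values above [i.+1] and raises [1, ..., i], which
   is [up 1]. Each [gmap n m] then lowers one value back, turning [up m] into [up m.+1], until only
   [i] is raised. *)
have Pup d : (d < i)%N -> P (fun a => inord (up d.+1 (z a))).
  elim: d => [|d IH] lt.
    apply: (Ph _ _ (Pdown (n.-1 - i.+2)%N _)); first lia.
    move=> a; apply/hmapP; have zna := zn a; have [za _] := fz a.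
    by rewrite /down /up !inordE; repeat case: ifP; lia.
  apply: (Pg _ _ d.+1 _ _ (IH _)); try lia.
  move=> a; apply/gmapP; first lia.
  have zna := zn a; have [za _] := fz a.
  by rewrite /up !inordE; repeat case: ifP; lia.
have -> : z' = (fun a => inord (up i (z a))).
  apply: funext => a; apply: val_inj; have [_ /= ->] := fz a; have zna := zn a.
  by rewrite /up inordE; repeat case: ifP; lia.
by have := Pup i.-1; rewrite prednK //; apply; lia.
Qed.

(** * Duality *)

Lemma sig_inj (T : Type) (P : T -> Prop) (x y : {a | P a}) :
  proj1_sig x = proj1_sig y -> x = y.
Proof.
by case: x y => [x px] [y py] /= exy; subst y; congr exist; apply: Prop_irrelevance.
Qed.

Lemma leq_cmeet n (k : nat) (a b : Cn n) : (k <= cmeet n a b)%N = (k <= a)%N && (k <= b)%N.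
Proof. by rewrite /cmeet; case: ifP; lia. Qed.

Lemma geq_cmeet n (k : nat) (a b : Cn n) : (cmeet n a b <= k)%N = (a <= k)%N || (b <= k)%N.
Proof. by rewrite /cmeet; case: ifP; lia. Qed.

Lemma leq_cjoin n (k : nat) (a b : Cn n) : (k <= cjoin n a b)%N = (k <= a)%N || (k <= b)%N.
Proof. by rewrite /cjoin; case: ifP; lia. Qed.

Lemma geq_cjoin n (k : nat) (a b : Cn n) : (cjoin n a b <= k)%N = (a <= k)%N && (b <= k)%N.
Proof. by rewrite /cjoin; case: ifP; lia. Qed.

Lemma closed_eq n (S : Type) (Y : (S -> Cn n) -> Prop) (F : list S) :
  (forall x y, (forall s, List.In s F -> y s = x s) -> Y y -> Y x) -> closedP n S Y.
Proof. by move=> YF x nYx; exists F => y yx /(YF _ _ yx). Qed.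

Lemma closed_forall n (S I : Type) (Y : I -> (S -> Cn n) -> Prop) :
  (forall i, closedP n S (Y i)) -> closedP n S (fun x => forall i, Y i x).
Proof.
move=> clY x /existsNP[i nYx]; have [F HF] := clY i x nYx.
by exists F => y /HF nYy /(_ i).
Qed.

Lemma closed_and n (S : Type) (Y Z : (S -> Cn n) -> Prop) :
  closedP n S Y -> closedP n S Z -> closedP n S (fun x => Y x /\ Z x).
Proof.
move=> clY clZ x /not_andP[/clY|/clZ] [F HF]; exists F => y /HF nY [] //.
Qed.

(** Each homomorphism equation involves at most three coordinates. *)
Lemma closed_hom n (A : HAlg) : closedP n A (is_hom A (Cn_alg n)).
Proof.
do 4 ?[apply: closed_and]; try apply: closed_forall => a; try apply: closed_forall => b.
- by apply: (closed_eq _ _ _ [:: hmeet A a b; a; b]) => x y xy; rewrite !xy //=; tauto.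
- by apply: (closed_eq _ _ _ [:: hjoin A a b; a; b]) => x y xy; rewrite !xy //=; tauto.
- by apply: (closed_eq _ _ _ [:: himp A a b; a; b]) => x y xy; rewrite !xy //=; tauto.
- by apply: (closed_eq _ _ _ [:: hbot A]) => x y xy; rewrite !xy //=; tauto.
- by apply: (closed_eq _ _ _ [:: htop A]) => x y xy; rewrite !xy //=; tauto.
Qed.

(** By [hom_le], the filter of elements sent to the top also determines the order of the values. *)
Lemma initial_hom_unique n (A : HAlg) (z z' : A -> Cn n) :
  is_hom A (Cn_alg n) z -> is_hom A (Cn_alg n) z' ->
  initial n A z -> initial n A z' ->
  (forall a, z a = ctop n <-> z' a = ctop n) -> z = z'.
Proof.
move=> hz hz' iz iz' top; apply: initial_unique => // a b.
by rewrite (hom_le _ _ _ _ _ hz) (hom_le _ _ _ _ _ hz').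
Qed.

Section Duality.
Variables (n : nat) (ops : 'I_(n-2) -> pop n).
Hypothesis ops_g : forall i, (0 < i)%N -> (i.+1 < n.-1)%N -> exists I, ops I = gmap n i.
Hypothesis ops_h : exists I, ops I = hmap n 1.
Hypothesis ops_endo : forall I, pendo n (ops I).

Lemma gmap_total i (T : Type) (x : T -> Cn n) : (i < n.-1)%N -> (forall a, x a <> i :> nat) ->
  exists x', forall a, gmap n i (x a) = Some (x' a).
Proof.
move=> iN xi; exists (fun a => inord (if x a == i.+1 :> nat then i else x a)) => a.
apply/gmapP => //; split=> //; rewrite inordK //.
by have := cn_le n (x a); case: ifP; lia.
Qed.

Lemma hmap_total (T : Type) (x : T -> Cn n) :
  exists x', forall a, hmap n 1 (x a) = Some (x' a).
Proof. by eexists => a; reflexivity. Qed.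

(** * Morphisms from the dual of an algebra to the alter ego *)

Section DualOfAlgebra.
Variable A : HAlg.
Variable alpha : DA n A -> Cn n.
Hypothesis alphaE : isE n ops (Dstr n ops A) alpha.

Lemma hom_step (p : pop n) (x : DA n A) (x' : A -> Cn n) :
  (exists I, ops I = p) -> (forall a, p (proj1_sig x a) = Some (x' a)) ->
  exists y : DA n A, proj1_sig y = x' /\ p (alpha x) = Some (alpha y).
Proof.
move=> [I <-] px; have [_ al] := alphaE.
have hx' : is_hom A (Cn_alg n) x'.
  exact: (pendo_comp_hom _ _ _ _ _ (ops_endo I) (proj2_sig x) px).
by exists (exist _ x' hx'); split=> //; apply: al.
Qed.

Lemma dual_normal_form (x : DA n A) (v : nat) : (0 < v)%N -> (v <= n.-1)%N ->
  exists y : DA n A, [/\ initial n A (proj1_sig y),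
    forall a, (v <= proj1_sig x a)%N <-> proj1_sig y a = ctop n &
    (v <= alpha x)%N <-> alpha y = ctop n].
Proof.
move=> v0 vn.
(* The value of [alpha] is adjoined as the coordinate [None], so that the shift treats
   [v <= alpha x] like the conditions on the values of [x]. *)
pose ev (x : DA n A) (o : option A) := if o is Some a then proj1_sig x a else alpha x.
have [|x1 x1P] := shift_to_top n _ _ ev _ x v v0 vn.
  move=> z; have [z' hz'] := hmap_total _ (proj1_sig z).
  have [y [yz' hy]] := hom_step _ z z' ops_h hz'.
  by exists y => -[a|//]; rewrite /ev yz'.
(* Now the value of [alpha] stays out of the range to be compressed; each [gmap n i] used preserves
   whether it is the top. *)
have [||y [iny top ty]] := initial_reachable n A (DA n A) (fun y => proj1_sig y)
  (fun y => alpha y = ctop n) _ _ x1.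
- by move=> z; exists (hbot A); case: (proj2_sig z) => _ [_ [_ []]].
- move=> z i i0 iN zi; have [|z' hz'] := gmap_total i _ (proj1_sig z) _ zi; first lia.
  have [y [yz' hy]] := hom_step _ z z' (ops_g i i0 iN) hz'.
  exists y; rewrite yz'; split=> //.
  have [|az ay] := proj1 (gmapP n i (alpha z) (alpha y) _) hy; first lia.
  by rewrite !ctopP; move: ay; case: ifP; lia.
- exists y; split=> // [a|]; first by rewrite -top; apply: (x1P (Some a)).
  by rewrite -ty; apply: (x1P None).
Qed.

(** Otherwise the filter of [x] above [x b0], for a suitable [b0], equals that of [y] above
    [alpha y]. The common normal form is sent by [alpha] to the top on the side of [x], but not on
    that of [y]. *)
Lemma one_sided_interpolation (x y : DA n A) :
  exists a, (alpha x <= proj1_sig x a)%N /\ (proj1_sig y a <= alpha y)%N.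
Proof.
apply: contrapT => /forallNP nint.
have {}nint a : (alpha x <= proj1_sig x a)%N -> (alpha y < proj1_sig y a)%N.
  by move=> xa; rewrite ltnNge; apply/negP => ya; apply: (nint a).
have [_ [_ [ximp [xbot xtop]]]] := proj2_sig x.
have [_ [_ [yimp [ybot ytop]]]] := proj2_sig y.
have ay : (alpha y < n.-1)%N.
  have := nint (htop A); rewrite xtop /= => /(_ (cn_le n _)); rewrite ytop /=; lia.
have [|b0 [yb0 b0max]] :=
  max_witness n A (fun b => (proj1_sig y b <= alpha y)%N) (proj1_sig x).
  by exists (hbot A); rewrite ybot.
have xb0 : (proj1_sig x b0 < alpha x)%N.
  by rewrite ltnNge; apply/negP => /nint; rewrite ltnNge yb0.
have key a : (proj1_sig x b0 < proj1_sig x a)%N <-> (alpha y < proj1_sig y a)%N.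
  split=> [xa|ya]; rewrite ltnNge; apply/negP => le.
    by have := b0max a le; lia.
  (* If [x a <= x b0], then [x] sends [himp A a b0] to the top, so [y] must exceed [alpha y] there;
     yet [y] takes there the value [y b0]. *)
  have := nint (himp A a b0); rewrite ximp yimp /= {1}/cimp le => /(_ (cn_le n _)).
  by rewrite /cimp; case: ifP; lia.
have [||x1 [ix1 x1a ax1]] := dual_normal_form x (proj1_sig x b0).+1 => //.
  by have := cn_le n (alpha x); lia.
have [||y1 [iy1 y1a ay1]] := dual_normal_form y (alpha y).+1 => //.
have exy : x1 = y1.
  apply: sig_inj; apply: initial_hom_unique => //; try exact: proj2_sig.
  by move=> a; rewrite -x1a -y1a.
by have /ax1 : (proj1_sig x b0 < alpha x)%N by []; rewrite exy => /ay1; rewrite ltnn.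
Qed.

(** For fixed [y], compactness and joins give an evaluation above [alpha] everywhere and equal to it
    at [y]; compactness and meets over all [y] then bring it down to [alpha]. *)
Lemma evaluation_onto : exists a, evalA n A a = alpha.
Proof.
pose Y := is_hom A (Cn_alg n).
have [cont _] := alphaE.
have nbhd (x : DA n A) : exists F : list A, forall y : DA n A,
    (forall a, List.In a F -> proj1_sig y a = proj1_sig x a) -> alpha y = alpha x.
  by have [F HF] := cont (fun v => v = alpha x) x erefl; exists F.
have hmeetE (x : DA n A) a b :
    proj1_sig x (hmeet A a b) = cmeet n (proj1_sig x a) (proj1_sig x b).
  by case: (proj2_sig x).
have hjoinE (x : DA n A) a b :
    proj1_sig x (hjoin A a b) = cjoin n (proj1_sig x a) (proj1_sig x b).
  by case: (proj2_sig x) => _ [].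
have above (y : DA n A) : exists a, (proj1_sig y a <= alpha y)%N /\
    forall x : DA n A, (alpha x <= proj1_sig x a)%N.
  have [||||a [Qa Ua]] := directed_compactness n A Y A
    (fun a => (proj1_sig y a <= alpha y)%N)
    (fun a z => forall hz : Y z, (alpha (exist _ z hz) <= z a)%N).
  - exact: closed_hom.
  - by exists (hbot A); case: (proj2_sig y) => _ [_ [_ [-> _]]].
  - move=> a b Qa Qb; exists (hjoin A a b); split; first by rewrite hjoinE geq_cjoin Qa.
    move=> z Uab hz; have := hjoinE (exist _ z hz) a b; rewrite /= => ->.
    by rewrite leq_cjoin; apply/orP; case: Uab => /(_ hz); [left|right].
  - move=> z hz; pose x : DA n A := exist _ z hz.
    have [a [xa ya]] := one_sided_interpolation x y.
    have [F HF] := nbhd x; exists a; split=> //; exists (a :: F) => w _ wz hw.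
    rewrite (HF (exist _ w hw)); last by move=> b Fb; apply: wz; right.
    by rewrite wz //; left.
  - by exists a; split=> // -[z hz]; apply: Ua.
have [||||a [Qa Ua]] := directed_compactness n A Y A
  (fun a => forall x : DA n A, (alpha x <= proj1_sig x a)%N)
  (fun a z => forall hz : Y z, (z a <= alpha (exist _ z hz))%N).
- exact: closed_hom.
- exists (htop A) => x; case: (proj2_sig x) => _ [_ [_ [_ ->]]]; exact: cn_le.
- move=> a b Qa Qb; exists (hmeet A a b); split.
    by move=> x; rewrite hmeetE leq_cmeet Qa Qb.
  move=> z Uab hz; have := hmeetE (exist _ z hz) a b; rewrite /= => ->.
  by rewrite geq_cmeet; apply/orP; case: Uab => /(_ hz); [left|right].
- move=> z hz; pose y : DA n A := exist _ z hz.
  have [a [ya xa]] := above y.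
  have [F HF] := nbhd y; exists a; split=> //; exists (a :: F) => w _ wz hw.
  rewrite (HF (exist _ w hw)); last by move=> b Fb; apply: wz; right.
  by rewrite wz //; left.
- exists a; apply: funext => -[z hz]; apply: val_inj; apply/eqP.
  rewrite eqn_leq /evalA /=; apply/andP; split; first exact: Ua.
  exact: (Qa (exist _ z hz)).
Qed.

End DualOfAlgebra.

Lemma duality A : in_Gn n A -> e_iso n ops A.
Proof.
move=> [S [f [injf hf]]]; split; [|split; [|split]].
- move=> a; split=> [V x Vx|i x x' /(_ a)//].
  by exists [:: a] => y yx; rewrite /evalA yx //; left.
- move=> a b eab; apply: injf; apply: funext => s.
  (* The coordinates of the embedding are points of the dual, and they separate the elements of
     [A]. *)
  have hs : is_hom A (Cn_alg n) (fun a => f a s).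
    have [fm [fj [fi [fb ft]]]] := hf.
    by split; [|split; [|split; [|split]]] => [u v|u v|u v||]; rewrite ?fm ?fj ?fi ?fb ?ft.
  exact: (f_equal (fun e => e (exist _ _ hs)) eab).
- exact: evaluation_onto.
- split; [|split; [|split; [|split]]] => [u v|u v|u v||]; apply: funext => -[x hx] /=;
    case: hx => xm [xj [xi [xb xt]]]; [exact: xm|exact: xj|exact: xi|exact: xb|exact: xt].
Qed.

End Duality.

(** * Fullness *)

Section Fullness.
Variables (n : nat) (ops : 'I_(n-2) -> pop n).
Hypothesis n_gt1 : (1 < n)%N.
Hypothesis ops_g : forall i, (0 < i)%N -> (i.+1 < n.-1)%N -> exists I, ops I = gmap n i.
Hypothesis ops_h : exists I, ops I = hmap n 1.
Hypothesis ops_endo : forall I, pendo n (ops I).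

Variables (X : TStr n) (S : Type) (Y : (S -> Cn n) -> Prop) (phi : X -> S -> Cn n).
Hypothesis clY : closedP n S Y.
Hypothesis subY : substrP n ops S Y.
Hypothesis isoX : iso_into n ops X S Y phi.

Lemma topen_local (U : X -> Prop) :
  topen n X U <-> forall x, U x -> exists F : list S,
    forall z, (forall s, List.In s F -> phi z s = phi x s) -> U z.
Proof.
have [Yphi [injphi [onto [top _]]]] := isoX.
rewrite top; split=> [op x Ux|loc y [x [Ux <-]]].
  have [F HF] := op (phi x) (ex_intro _ x (conj Ux erefl)).
  by exists F => z zx; have [w [Uw /injphi <-]] := HF (phi z) (Yphi z) zx.
have [F HF] := loc x Ux; exists F => z /onto[w <-] wx.
by exists w; split=> //; apply: HF.
Qed.

Definition locconst (al : X -> Cn n) := forall x, exists F : list S,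
  forall z, (forall s, List.In s F -> phi z s = phi x s) -> al z = al x.

Lemma isE_local (al : X -> Cn n) : isE n ops X al <->
  locconst al /\ (forall i x x', trel n X i x x' -> ops i (al x) = Some (al x')).
Proof.
split=> -[cont pres]; split=> //.
  by move=> x; have /topen_local/(_ x erefl) := cont (fun v => v = al x).
move=> V; apply/topen_local => x Vx; have [F HF] := cont x.
by exists F => z /HF ->.
Qed.

Lemma isE_coord s : isE n ops X (fun x => phi x s).
Proof.
apply/isE_local; split=> [x|i x x'].
  by exists [:: s] => z; apply; left.
by have [_ [_ [_ [_ ->]]]] := isoX.
Qed.

Lemma isE_const v : (forall I, ops I v = Some v) -> isE n ops X (fun=> v).
Proof. by move=> opv; apply/isE_local; split=> // x; exists nil. Qed.

Lemma isE_lift2 (m : Cn n -> Cn n -> Cn n) al be :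
  (forall I a b a' b', ops I a = Some a' -> ops I b = Some b' ->
    ops I (m a b) = Some (m a' b')) ->
  isE n ops X al -> isE n ops X be -> isE n ops X (fun x => m (al x) (be x)).
Proof.
move=> opm /isE_local[ca pa] /isE_local[cb pb]; apply/isE_local; split=> [x|i x x' xx'].
  have [F HF] := ca x; have [G HG] := cb x; exists (F ++ G)%list => z zx.
  rewrite HF ?HG // => s Gs; apply: zx; apply/List.in_app_iff; [by right|by left].
by apply: opm; [apply: pa|apply: pb].
Qed.

Definition elift2 m opm (al be : EX n ops X) : EX n ops X :=
  exist _ _ (isE_lift2 m _ _ opm (proj2_sig al) (proj2_sig be)).

(** Bundling E(X) as an algebra makes the normal forms of homomorphisms available for points of
    DE(X). *)
Definition Ealg : HAlg :=
  {| hcar := EX n ops X;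
     hmeet := elift2 (cmeet n) (fun I _ _ _ _ => pendo_meet n _ _ _ _ _ (ops_endo I));
     hjoin := elift2 (cjoin n) (fun I _ _ _ _ => pendo_join n _ _ _ _ _ (ops_endo I));
     himp := elift2 (cimp n) (fun I _ _ _ _ => pendo_imp n _ _ _ _ _ (ops_endo I));
     hbot := exist _ _ (isE_const (cbot n) (fun I => let: And4 b _ _ _ := ops_endo I in b));
     htop := exist _ _ (isE_const (ctop n) (fun I => let: And4 _ t _ _ := ops_endo I in t)) |}.

Lemma EX_hom_Ealg (beta : EX n ops X -> Cn n) :
  EX_hom n ops X beta <-> is_hom Ealg (Cn_alg n) beta.
Proof.
have E (a b : EX n ops X) : (forall x, proj1_sig a x = proj1_sig b x) -> a = b.
  by move=> ab; apply: sig_inj; apply: funext.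
split=> -[bm [bj [bi [bb bt]]]]; split;
  [|split; [|split; [|split]]| |split; [|split; [|split]]].
- by move=> a b; apply: bm.
- by move=> a b; apply: bj.
- by move=> a b; apply: bi.
- exact: bb.
- exact: bt.
- by move=> a b c /(E c (hmeet Ealg a b)) ->; apply: bm.
- by move=> a b c /(E c (hjoin Ealg a b)) ->; apply: bj.
- by move=> a b c /(E c (himp Ealg a b)) ->; apply: bi.
- by move=> a /(E a (hbot Ealg)) ->.
- by move=> a /(E a (htop Ealg)) ->.
Qed.

Notation eps := (epsX n ops X).

Lemma eps_hom x : is_hom Ealg (Cn_alg n) (eps x).
Proof. by []. Qed.

Lemma eps_step I x : (forall s, ops I (phi x s) <> None) ->
  exists x', forall al : EX n ops X, ops I (eps x al) = Some (eps x' al).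
Proof.
have [Yphi [_ [onto [_ rel]]]] := isoX.
move=> dom; have [x' ex'] := onto _ (subY I _ (Yphi x) dom).
exists x' => al; have [_ pres] := proj2_sig al; apply: pres; apply/rel => s.
by rewrite ex'; case: (ops I (phi x s)) (dom s).
Qed.

Definition inX (z : Ealg -> Cn n) := exists x, eps x = z.

Lemma inX_g z z' i : (0 < i)%N -> (i.+1 < n.-1)%N -> inX z ->
  (forall a, gmap n i (z a) = Some (z' a)) -> inX z'.
Proof.
move=> i0 iN [x <-] gz; have [I eI] := ops_g i i0 iN.
have [|x' hx'] := eps_step I x.
  (* Each coordinate of [phi] is a morphism, so [gmap n i] is defined at [phi x] once it is defined
     on all values of [eps x]. *)
  by move=> s; rewrite eI; have := gz (exist _ _ (isE_coord s)); rewrite /epsX /= => ->.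
by exists x'; apply: funext => al; have := hx' al; rewrite eI gz => -[].
Qed.

Lemma inX_h z z' : inX z -> (forall a, hmap n 1 (z a) = Some (z' a)) -> inX z'.
Proof.
move=> [x <-] hz; have [I eI] := ops_h.
have [|x' hx'] := eps_step I x; first by move=> s; rewrite eI.
by exists x'; apply: funext => al; have := hx' al; rewrite eI hz => -[].
Qed.

(* Otherwise compactness yields [c <= b] in [E(X)] with [beta c] top and [beta b]
   not, against [beta] being a homomorphism. *)
Lemma prime_filter_realised (beta : Ealg -> Cn n) : is_hom Ealg (Cn_alg n) beta ->
  exists x, forall c b, beta c = ctop n -> beta b <> ctop n -> (eps x b < eps x c)%N.
Proof.
move=> hb; have [bm [bj [bi [bbot btop]]]] := hb.
apply: contrapT => /forallNP nx.
have [Yphi [injphi [onto _]]] := isoX.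
have [||||[c b] [[/= bc bb] le]] := directed_compactness n S Y (Ealg * Ealg)
  (fun cb => beta cb.1 = ctop n /\ beta cb.2 <> ctop n)
  (fun cb y => forall x, phi x = y -> (eps x cb.1 <= eps x cb.2)%N).
- exact: clY.
- exists (htop Ealg, hbot Ealg); split=> //=; rewrite bbot => /ctopP /=; lia.
- move=> [c b] [c' b'] [/= bc bb] [/= bc' bb'].
  (* In a chain, the join of two elements below the top is again below the top. *)
  exists (hmeet Ealg c c', hjoin Ealg b b'); split=> /=.
    rewrite bm bj bc bc'; split; first by rewrite /= /cmeet; case: ifP.
    by rewrite /= /cjoin; case: ifP.
  move=> y Uy x xy; rewrite /epsX /= leq_cjoin !geq_cmeet.
  by apply/orP; case: Uy => /(_ x xy) le; [left|right]; apply/orP; [left|right].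
- move=> y /onto[x <-].
  have /existsNP[c /existsNP[b /not_implyP[bc /not_implyP[bb /negP le]]]] := nx x.
  exists (c, b); split=> //=.
  have [/isE_local[cc _] /isE_local[cb _]] := (proj2_sig c, proj2_sig b).
  have [F HF] := cc x; have [G HG] := cb x; exists (F ++ G)%list => z Yz zx w wz.
  rewrite /epsX HF ?HG => [|s Fs|s Fs]; first by rewrite leqNgt.
    by rewrite wz; apply: zx; apply/List.in_app_iff; right.
  by rewrite wz; apply: zx; apply/List.in_app_iff; left.
have cb : himp Ealg c b = htop Ealg.
  apply: sig_inj; apply: funext => x /=; apply/cimp_top.
  by apply: (le (phi x)) => //; apply: Yphi.
have := bi c b; rewrite cb btop bc /= => /esym/cimp_top.
by move=> h; apply: bb; apply/ctopP; have := cn_le n (beta b); move: h => /=; lia.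
Qed.

Lemma evaluation_points_all (beta : Ealg -> Cn n) : is_hom Ealg (Cn_alg n) beta -> inX beta.
Proof.
move=> hb; have [x xb] := prime_filter_realised beta hb.
have [_ [_ [_ [bbot btop]]]] := hb.
(* The largest value [M] of [eps x] on elements that [beta] keeps below the top gives the threshold
   [M.+1] of the filter of [beta]. *)
have [|b0 [bb0 b0max]] := max_witness n Ealg (fun b => beta b <> ctop n) (eps x).
  by exists (hbot Ealg); rewrite bbot => /ctopP /=; lia.
pose M := (eps x b0 : nat).
have tops a : (M.+1 <= eps x a)%N <-> beta a = ctop n.
  split=> [lt|ba]; last exact: xb.
  by apply: contrapT => /b0max; rewrite /M in lt; lia.
have [|//||x1 x1P] := shift_to_top n Ealg {z | inX z} (fun z => proj1_sig z) _
    (exist _ (eps x) (ex_intro _ x erefl)) M.+1.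
- move=> [z Xz] /=; have [z' hz] := hmap_total _ _ z.
  by exists (exist _ z' (inX_h z z' Xz hz)).
- by have := xb (htop Ealg) b0 btop bb0; have := cn_le n (eps x (htop Ealg)); rewrite /M; lia.
have normal_form (z : Ealg -> Cn n) : is_hom Ealg (Cn_alg n) z ->
    exists z', [/\ is_hom Ealg (Cn_alg n) z', initial n Ealg z',
      forall a, z a = ctop n <-> z' a = ctop n & inX z <-> inX z'].
  move=> hz; have [||[z' hz'] /= [iz' top tz']] := initial_reachable n Ealg
    {z | is_hom Ealg (Cn_alg n) z} (fun z => proj1_sig z) (fun z => inX (proj1_sig z))
    _ _ (exist _ z hz); last by exists z'.
    by move=> [w hw]; have [_ [_ [_ [wb _]]]] := hw; exists (hbot Ealg).
  move=> [w hw] i i0 iN wi /=; have [|w' gw] := gmap_total n i _ w _ wi; first lia.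
  have hw' := pendo_comp_hom _ _ _ _ _ (pendo_gmap n i i0 iN) hw gw.
  (* Membership in [X] passes back as well: [fmap n i] undoes [gmap n i], and [f_closed] applies. *)
  exists (exist _ w' hw'); split=> //=; split=> [Xw|Xw']; first exact: (inX_g w w' i).
  apply: (f_closed n Ealg inX inX_g inX_h w' w i) => // a.
  have iN' : (i < n.-1)%N by lia.
  have [wa w'a] := proj1 (gmapP n i _ _ iN') (gw a).
  by apply/fmapP; [lia|split; move: w'a; repeat case: ifP; lia].
have hx1 : is_hom Ealg (Cn_alg n) (proj1_sig x1) by have [y <-] := proj2_sig x1.
have [z [hz iz topz Xz]] := normal_form _ hx1.
have [b [hb' ib topb ->]] := normal_form _ hb.
suff -> : b = z by apply/Xz; apply: (proj2_sig x1).
apply: initial_hom_unique => // a.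
by rewrite -topb -topz -x1P -tops.
Qed.

Lemma evaluation_iso : eps_iso n ops X.
Proof.
have [Yphi [injphi [onto [_ rel]]]] := isoX.
split; [|split; [|split; [|split]]].
- by move=> x; apply/EX_hom_Ealg/eps_hom.
- move=> x y exy; apply: injphi; apply: funext => s.
  exact: (f_equal (fun e => e (exist _ _ (isE_coord s))) exy).
- by move=> beta /EX_hom_Ealg/evaluation_points_all.
- move=> U; rewrite topen_local; split=> [loc _ [x [Ux <-]]|op x Ux].
    have [F HF] := loc x Ux.
    exists (List.map (fun s => exist _ _ (isE_coord s)) F).
    move=> _ /EX_hom_Ealg/evaluation_points_all[z <-] zx; exists z; split=> //.
    apply: HF => s Fs; apply: (zx (exist _ _ (isE_coord s))).
    by apply/List.in_map_iff; exists s.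
  have [F HF] := op (eps x) (ex_intro _ x (conj Ux erefl)).
  (* Morphisms are locally constant, so finitely many of them are controlled near [x] by finitely
     many coordinates of [phi]. *)
  have [G HG] : exists G : list S, forall z, (forall s, List.In s G -> phi z s = phi x s) ->
      forall al, List.In al F -> eps z al = eps x al.
    elim: F {HF} => [|al F [G HG]]; first by exists nil.
    have /isE_local[cal _] := proj2_sig al; have [H HH] := cal x.
    exists (H ++ G)%list => z zx be [<-|Fbe].
      by apply: HH => s Hs; apply: zx; apply/List.in_app_iff; left.
    by apply: HG => // s Gs; apply: zx; apply/List.in_app_iff; right.
  exists G => z zx; have hz : EX_hom n ops X (eps z) by apply/EX_hom_Ealg/eps_hom.
  have [w [Uw ewz]] := HF (eps z) hz (HG z zx).
  suff <- : w = z by [].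
  apply: injphi; apply: funext => s.
  exact: (f_equal (fun e => e (exist _ _ (isE_coord s))) ewz).
- move=> i x x'; split=> [xx' al|exx'].
    by have [_ pres] := proj2_sig al; apply: pres.
  by apply/rel => s; apply: (exx' (exist _ _ (isE_coord s))).
Qed.

End Fullness.

(** * The alter egos of the theorem *)

Section SigmaOps.
Variables (n : nat) (c : 'I_(n-3) -> bool) (j : 'I_(n-2)).
Hypothesis hn : (4 <= n)%N.

Lemma sigma_op_lt (k : 'I_(n-3)) (I : 'I_(n-2)) : I = k :> nat ->
  sigma_op n c j I = if c k then gmap n k.+1 else fmap n k.+1.
Proof.
move=> Ik; rewrite /sigma_op; case: insubP => [l _ el|]; last by rewrite /= Ik ltn_ord.
suff -> : l = k by [].
by apply: val_inj; rewrite el.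
Qed.

Lemma sigma_op_last (I : 'I_(n-2)) : I = n - 3 :> nat -> sigma_op n c j I = hmap n j.+1.
Proof. by move=> In; rewrite /sigma_op insubN //= In ltnn. Qed.

Lemma sigma_opP (I : 'I_(n-2)) :
  (exists k, sigma_op n c j I = if c k then gmap n k.+1 else fmap n k.+1) \/
  sigma_op n c j I = hmap n j.+1.
Proof.
have [lt|ge] := ltnP I (n - 3).
  by left; exists (Ordinal lt); apply: sigma_op_lt.
by right; apply: sigma_op_last; have := ltn_ord I; lia.
Qed.

Lemma sigma_op_surj (k : 'I_(n-3)) :
  exists I, sigma_op n c j I = if c k then gmap n k.+1 else fmap n k.+1.
Proof.
have lt : (k < n - 2)%N by have := ltn_ord k; lia.
by exists (Ordinal lt); apply: sigma_op_lt.
Qed.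

Lemma sigma_op_hmap : exists I, sigma_op n c j I = hmap n j.+1.
Proof.
have lt : (n - 3 < n - 2)%N by lia.
by exists (Ordinal lt); apply: sigma_op_last.
Qed.

Lemma g_h1_full : (forall k, c k = true) -> j = 0 :> nat ->
  full_duality n (sigma_op n c j).
Proof.
move=> cg j0.
have ops_h : exists I, sigma_op n c j I = hmap n 1.
  by have [I eI] := sigma_op_hmap; exists I; rewrite eI j0.
have ops_g i : (0 < i)%N -> (i.+1 < n.-1)%N -> exists I, sigma_op n c j I = gmap n i.
  move=> i0 iN; have lt : (i.-1 < n - 3)%N by lia.
  by have [I eI] := sigma_op_surj (Ordinal lt); exists I; rewrite eI cg /= prednK.
have ops_endo I : pendo n (sigma_op n c j I).
  have [[k ->]|->] := sigma_opP I; last exact: pendo_hmap.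
  by rewrite cg; apply: pendo_gmap; have := ltn_ord k; lia.
split; first exact: duality.
move=> X [S [Y [phi [clY [subY isoX]]]]].
by apply: (evaluation_iso _ _ _ _ _ _ X S Y phi) => //; lia.
Qed.

(* [alpha |-> r (alpha k)], where [r] sends [k] to [l] and fixes [0] and [n-1], is
   a homomorphism on [E(Q)]; evaluated at the inclusion of [Q] it gives [l]. *)
Lemma missing_point_not_full (ops : 'I_(n-2) -> pop n) (Q : pred (Cn n)) (k l : Cn n)
    (Qk : Q k) :
  (forall I a b, Q a -> ops I a = Some b -> Q b) ->
  ~~ Q l -> (0 < k < n.-1)%N -> (0 < l < n.-1)%N ->
  (forall al : {a | Q a} -> Cn n,
     (forall I x x', ops I (sval x) = Some (sval x') -> ops I (al x) = Some (al x')) ->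
     forall x, sval x = k -> [\/ al x = cbot n, al x = k | al x = ctop n]) ->
  ~ full_duality n ops.
Proof.
move=> Qcl nQl kb lb rigid [_ full].
(* [Q] is a substructure of the first power, with exponent [unit], and is discrete. *)
pose X : TStr n := {| tcar := {a | Q a}; topen := fun=> True;
  trel := fun I x x' => ops I (sval x) = Some (sval x') |}.
have XX : in_Xsig n ops X.
  exists unit, (fun x => Q (x tt)), (fun x _ => sval x).
  split; first by move=> x nQx; exists [:: tt] => y yx; rewrite yx //; left.
  split.
    by move=> I x Qx /(_ tt); case e: (ops I (x tt)) => [b|] // _; apply: (Qcl I (x tt)).
  split; first by case.
  split; first by move=> x y exy; apply: sig_inj; apply: (f_equal (@^~ tt) exy).
  split; first by move=> y Qy; exists (exist _ (y tt) Qy); apply: funext => -[].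
  split; last by move=> I x x'; split=> [//|/(_ tt)].
  move=> U; split=> // _ y Uy; exists [:: tt] => z _ zy.
  by have -> : z = y by apply: funext => -[]; apply: zy; left.
have [_ [_ [onto _]]] := full X XX.
pose x0 : X := exist _ k Qk.
pose r : pop n := fun v => if v == k :> nat then Some l
  else if (v == 0 :> nat) || (v == n.-1 :> nat) then Some v else None.
have rP a a' : r a = Some a' -> [\/ a = 0 :> nat /\ a' = 0 :> nat,
    a = k :> nat /\ a' = l :> nat | a = n.-1 :> nat /\ a' = n.-1 :> nat].
  rewrite /r; case: eqP => [ek [<-]|_]; first by constructor 2.
  by case: ifP => // /orP[]/eqP ea [<-]; [constructor 1|constructor 3].
have r_endo : pendo n r.
  split=> [||a b a' b' /rP ha /rP hb|a b a' b' /rP ha /rP hb].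
  - by rewrite /r /=; case: eqP => //; lia.
  - by rewrite /r /= eqxx orbT; case: eqP => //; lia.
  - by case: ha => ?; case: hb => ?; lia.
  - by rewrite ctopP; case: ha => ?; case: hb => ?; lia.
(* By rigidity [al x0] lies in the domain of [r], so the default [cbot n] is never taken. *)
pose beta (al : EX n ops X) := odflt (cbot n) (r (proj1_sig al x0)).
have rbeta al : r (proj1_sig al x0) = Some (beta al).
  have [_ pres] := proj2_sig al; have := rigid _ pres x0 erefl.
  rewrite /beta /r => -[] -> /=; rewrite ?eqxx ?orbT //=; by case: eqP.
have [r0 r1 _ _] := r_endo.
have inj (a b : Cn n) : Some a = Some b -> a = b by case.
have [|x ex] := onto beta.
  split; [|split; [|split; [|split]]]
    => [a b d /(_ x0)|a b d /(_ x0)|a b d /(_ x0)|a /(_ x0)|a /(_ x0)] e;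
    apply: inj; rewrite -rbeta e //.
  - exact: pendo_meet.
  - exact: pendo_join.
  - exact: pendo_imp.
have incl : isE n ops X (fun x => sval x) by [].
have xl : sval x = l.
  have : r k = Some (sval x) by rewrite (rbeta (exist _ _ incl)) -ex.
  by rewrite /r eqxx => -[].
by move: nQl; rewrite -xl (proj2_sig x).
Qed.

(** Only [gmap n k.+1] could lead out of [{a | k.+1 < a}], and [fmap n k.+1] stands in its place.
    This substructure contains [n - 2] and misses [k.+1]. *)
Lemma fmap_in_sigma_not_full (k : 'I_(n-3)) : c k = false -> ~ full_duality n (sigma_op n c j).
Proof.
move=> ck.
have kN := ltn_ord k; have jN := ltn_ord j.
have inordE m : (m <= n.-1)%N -> (inord m : Cn n) = m :> nat by move=> ?; rewrite inordK.
have Iop (m : nat) : (0 < m)%N -> (m < n - 2)%N ->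
    exists I, sigma_op n c j I = gmap n m \/ sigma_op n c j I = fmap n m.
  move=> m0 mn; have lt : (m.-1 < n - 3)%N by lia.
  have [I eI] := sigma_op_surj (Ordinal lt); exists I; rewrite eI /= prednK //.
  by case: (c _); [left|right].
apply: (missing_point_not_full _ (fun a => (k.+1 < a)%N) (inord (n - 2)) (inord k.+1)).
- by rewrite inordE; lia.
- move=> I a b ka; have [[m ->]|->] := sigma_opP I; last by move/hmapP; case: ifP; lia.
  have mN := ltn_ord m.
  have [->|nmk] := eqVneq m k.
    by rewrite ck => /fmapP[|_]; [lia|case: ifP; lia].
  have {}nmk : m <> k :> nat by move=> e; case/eqP: nmk; apply: val_inj.
  by case: (c m); [move=> /gmapP[|_]|move=> /fmapP[|_]]; try lia; case: ifP; lia.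
- by rewrite inordE; lia.
- by rewrite inordE; lia.
- by rewrite inordE; lia.
move=> al pres x ex.
have xN : sval x = n - 2 :> nat by rewrite ex inordE; lia.
have Qtop : (k.+1 < ctop n)%N by move=> /=; lia.
pose top : {a : Cn n | (k.+1 < a)%N} := exist _ (ctop n) Qtop.
have [Ih eIh] := sigma_op_hmap.
have htop : hmap n j.+1 (al top) = Some (al top).
  by rewrite -eIh; apply: pres; rewrite eIh; apply/hmapP => /=; case: ifP; lia.
have hx : hmap n j.+1 (al x) = Some (al top).
  by rewrite -eIh; apply: pres; rewrite eIh; apply/hmapP => /=; case: ifP; lia.
have tn := cn_le n (al top).
(* All operations fix the top, hence also its image. But [n - 2] is moved by [hmap n j.+1], and any
   smaller [m > 0] is moved by [fmap n m] or outside the domain of [gmap n m]. *)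
have ends : al top = 0 :> nat \/ al top = n.-1 :> nat.
  apply: contrapT => /not_orP[t0 tN].
  have [tn2|tn2] := eqVneq (al top : nat) (n - 2)%N.
    by move/hmapP: htop; case: ifP; lia.
  have [||I eI] := Iop (al top); try lia.
  have : sigma_op n c j I (al top) = Some (al top).
    apply: pres; case: eI => ->; [apply/gmapP|apply/fmapP] => /=;
      try split; try case: ifP; lia.
  case: eI => ->; [move/gmapP|move/fmapP] => -[|? ]; try lia.
  by rewrite eqxx; lia.
have := hx => /hmapP; have xn := cn_le n (al x).
case: ifP => hj e.
  have : al x = n - 2 :> nat by lia.
  by move=> e'; constructor 2; apply: val_inj; rewrite /= e' inordE; lia.
case: ends => e'; [constructor 1|constructor 3]; apply: val_inj => /=; lia.
Qed.

(** Here [1] alone forms a substructure: [gmap n 1] is undefined at it, and all other operations fix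
    it. *)
Lemma hmap_in_sigma_not_full : (forall k, c k = true) -> (0 < j)%N ->
  ~ full_duality n (sigma_op n c j).
Proof.
move=> cg j0; have jN := ltn_ord j.
have inordE m : (m <= n.-1)%N -> (inord m : Cn n) = m :> nat by move=> ?; rewrite inordK.
apply: (missing_point_not_full _ (fun a => a == 1 :> nat) (inord 1) (inord 2)).
- by rewrite inordE; lia.
- move=> I a b /eqP a1; have [[m ->]|->] := sigma_opP I; last by move/hmapP; case: ifP; lia.
  by rewrite cg => /gmapP[|_]; have := ltn_ord m; [lia|case: ifP; lia].
- by rewrite inordE; lia.
- by rewrite inordE; lia.
- by rewrite inordE; lia.
move=> al pres x ex.
have x1 : sval x = 1 :> nat by rewrite ex inordE; lia.
have [Ih eIh] := sigma_op_hmap.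
have hx : hmap n j.+1 (al x) = Some (al x).
  by rewrite -eIh; apply: pres; rewrite eIh; apply/hmapP => /=; case: ifP; lia.
have an := cn_le n (al x).
have [a0|a0] := eqVneq (al x : nat) 0; first by constructor 1; apply: val_inj.
have [a1|a1] := eqVneq (al x : nat) 1.
  by constructor 2; apply: val_inj; rewrite /= inordE; lia.
have [aN|aN] := eqVneq (al x : nat) n.-1; first by constructor 3; apply: val_inj.
(* A value [m] with [1 < m < n.-1] fixed by [hmap n j.+1] is at most [j], so [gmap n m] is among the
   operations; it fixes [1] but is undefined at [m]. *)
have lt : ((al x).-1 < n - 3)%N by move/hmapP: hx; case: ifP; lia.
have [I] := sigma_op_surj (Ordinal lt); rewrite cg /= prednK ?lt0n // => eI.
have : sigma_op n c j I (al x) = Some (al x).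
  by apply: pres; rewrite eI; apply/gmapP; [lia|split; try case: ifP; lia].
by rewrite eI => /gmapP[|]; lia.
Qed.

End SigmaOps.

Theorem theorem5p1 (n : nat) (hn : (4 <= n)%N)
    (c : 'I_(n-3) -> bool) (j : 'I_(n-2)) :
  full_duality n (sigma_op n c j) <-> ((forall k, c k = true) /\ val j = 0%N).
Proof.
split=> [full|[cg j0]]; last exact: g_h1_full.
have cg k : c k = true.
  by case ck: (c k) => //; case: (fmap_in_sigma_not_full _ _ _ hn k ck full).
split=> //; apply/eqP; rewrite -leqn0 leqNgt; apply/negP => j0.
exact: (hmap_in_sigma_not_full _ _ _ hn cg j0 full).
Qed.
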